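(* Let $\mathcal{H}_A,\mathcal{H}_{B_1},\mathcal{H}_{B_2},\mathcal{H}_C$ be finite-dimensional Hilbert spaces and let the initial state be a product $\tau=\tau_{AB_1}\otimes\tau_{B_2C}$, where $\tau_{AB_1}$ is a density operator on $\mathcal{H}_A\otimes\mathcal{H}_{B_1}$ and $\tau_{B_2C}$ a density operator on $\mathcal{H}_{B_2}\otimes\mathcal{H}_C$. Let $\mathscr{B}=(B^b_{B_1B_2})_{b=0}^{3}$ be a four-outcome POVM on $\mathcal{H}_{B_1}\otimes\mathcal{H}_{B_2}$. Let $A_0,A_1$ be Hermitian operators on $\mathcal{H}_A$ and $C_0,C_1$ Hermitian operators on $\mathcal{H}_C$ with $A_x^2=\mathbb{1}$, $C_z^2=\mathbb{1}$. Suppose that for every $b\in\{0,1,2,3\}$ we have $p_b>0$ and $\operatorname{tr}(W_b\,\tau^b_{AC})=2\sqrt2$. Then there exist completely positive unital maps $\Lambda_{B_1}:\mathcal{L}(\mathcal{H}_{B_1})\to\mathcal{L}(\mathbb{C}^2)$ and $\Lambda_{B_2}:\mathcal{L}(\mathcal{H}_{B_2})\to\mathcal{L}(\mathbb{C}^2)$ such that $$(\Lambda_{B_1}\otimes\Lambda_{B_2})(B^b_{B_1B_2})=\Phi^b\qquad\text{for all } b\in\{0,1,2,3\}.$$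
   Context: Bell states on $\mathbb{C}^2\otimes\mathbb{C}^2$: $|\Phi^0\rangle=(|00\rangle+|11\rangle)/\sqrt2$, $|\Phi^1\rangle=(|00\rangle-|11\rangle)/\sqrt2$, $|\Phi^2\rangle=(|01\rangle+|10\rangle)/\sqrt2$, $|\Phi^3\rangle=(|01\rangle-|10\rangle)/\sqrt2$, and $\Phi^b:=|\Phi^b\rangle\langle\Phi^b|$; the Bell-state measurement is $\Phi=(\Phi^b)_{b=0}^3$. For Bob's outcome $b$: $p_b:=\operatorname{tr}[(\mathbb{1}_A\otimes B^b_{B_1B_2}\otimes\mathbb{1}_C)\tau]$ and (when $p_b>0$) $\tau^b_{AC}:=\frac1{p_b}\operatorname{tr}_{B_1B_2}[(\mathbb{1}_A\otimes B^b_{B_1B_2}\otimes\mathbb{1}_C)\tau]$. Bell operators on $\mathcal{H}_A\otimes\mathcal{H}_C$: $W_0:=A_0\otimes C_0+A_0\otimes C_1+A_1\otimes C_0-A_1\otimes C_1$, $W_1:=A_0\otimes C_0+A_0\otimes C_1-A_1\otimes C_0+A_1\otimes C_1$, $W_2:=-W_1$, $W_3:=-W_0$. A map $\Lambda$ is unital if $\Lambda(\mathbb{1})=\mathbb{1}$. *)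

(* Defs.v *)
(* Complex scalars: an arbitrary numClosedFieldType C
   (no analytic complex numbers are available). *)
From HB Require Import structures.
From mathcomp Require Import all_boot all_order all_algebra.
Set Implicit Arguments. Unset Strict Implicit. Unset Printing Implicit Defensive.
Import Order.TTheory GRing.Theory Num.Theory.
Local Open Scope ring_scope.

Section QDefs.
Variable C : numClosedFieldType.

(* conjugate transpose *)
Definition q_adj m n (M : 'M[C]_(m, n)) : 'M[C]_(n, m) := (map_mx (fun z => z^*) M)^T.

Definition q_hermitian n (M : 'M[C]_n) : Prop := q_adj M = M.

(* positive semidefinite operator *)
Definition q_psd n (M : 'M[C]_n) : Prop :=
  forall v : 'cV[C]_n, 0 <= (q_adj v *m M *m v) 0 0.

(* q_density operator *)
Definition q_density n (M : 'M[C]_n) : Prop := q_psd M /\ \tr M = 1.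

(* four-outcome POVM *)
Definition q_povm4 n (B : 'I_4 -> 'M[C]_n) : Prop :=
  (forall b, q_psd (B b)) /\ \sum_(b < 4) B b = 1%:M.

(* splitting a composite index of 'I_(m*n) into its two components,
   inverse of mxvec_index *)
Definition q_isplit m n (k : 'I_(m * n)) : 'I_m * 'I_n :=
  enum_val (cast_ord (esym (mxvec_cast m n)) k).

(* Kronecker (tensor) product of matrices, basis |i>|j> <-> mxvec_index i j *)
Definition q_tens m1 n1 m2 n2 (A : 'M[C]_(m1, n1)) (B : 'M[C]_(m2, n2))
  : 'M[C]_(m1 * m2, n1 * n2) :=
  \matrix_(i, j) (A (q_isplit i).1 (q_isplit j).1 * B (q_isplit i).2 (q_isplit j).2).

(* partial trace over the middle factor of H_m (x) H_n (x) H_k *)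
Definition q_ptrace_mid m n k (Y : 'M[C]_(m * n * k)) : 'M[C]_(m * k) :=
  \matrix_(i, j) \sum_(beta < n)
     Y (mxvec_index (mxvec_index (q_isplit i).1 beta) (q_isplit i).2)
       (mxvec_index (mxvec_index (q_isplit j).1 beta) (q_isplit j).2).

(* linearity of a map between operator spaces *)
Definition q_lin n m (f : 'M[C]_n -> 'M[C]_m) : Prop :=
  forall (a : C) (x y : 'M[C]_n), f (a *: x + y) = a *: f x + f y.

(* tensor product of two (linear) maps, defined on matrix units *)
Definition q_tensmap n1 m1 n2 m2 (f : 'M[C]_n1 -> 'M[C]_m1) (g : 'M[C]_n2 -> 'M[C]_m2)
  (X : 'M[C]_(n1 * n2)) : 'M[C]_(m1 * m2) :=
  \sum_(i < n1) \sum_(j < n1) \sum_(k < n2) \sum_(l < n2)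
     X (mxvec_index i k) (mxvec_index j l) *: q_tens (f (delta_mx i j)) (g (delta_mx k l)).

(* completely positive: id_k (x) f is positive for every k *)
Definition q_cp n m (f : 'M[C]_n -> 'M[C]_m) : Prop :=
  forall (k : nat) (X : 'M[C]_(k * n)), q_psd X -> q_psd (q_tensmap (fun Y : 'M[C]_k => Y) f X).

Definition q_unital n m (f : 'M[C]_n -> 'M[C]_m) : Prop := f 1%:M = 1%:M.

(* computational basis of C^2 and Bell states on C^2 (x) C^2 *)
Definition q_ket (i : 'I_2) : 'cV[C]_2 := delta_mx i 0.
Definition q_ket2 (i j : 'I_2) : 'cV[C]_(2 * 2) := q_tens (q_ket i) (q_ket j).

Definition q_bell_vec (b : 'I_4) : 'cV[C]_(2 * 2) :=
  (sqrtC 2)^-1 *: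
  match val b return 'cV[C]_(2 * 2) with
  | 0 => q_ket2 0 0 + q_ket2 1 1
  | 1 => q_ket2 0 0 - q_ket2 1 1
  | 2 => q_ket2 0 1 + q_ket2 1 0
  | _ => q_ket2 0 1 - q_ket2 1 0
  end.

Definition q_bell (b : 'I_4) : 'M[C]_(2 * 2) := q_bell_vec b *m q_adj (q_bell_vec b).

(* Bell operators W_b on H_A (x) H_C *)
Definition q_W dA dC (A0 A1 : 'M[C]_dA) (C0 C1 : 'M[C]_dC) (b : 'I_4) : 'M[C]_(dA * dC) :=
  let W0 := q_tens A0 C0 + q_tens A0 C1 + q_tens A1 C0 - q_tens A1 C1 in
  let W1 := q_tens A0 C0 + q_tens A0 C1 - q_tens A1 C0 + q_tens A1 C1 in
  match val b return 'M[C]_(dA * dC) with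
  | 0 => W0
  | 1 => W1
  | 2 => - W1
  | _ => - W0
  end.

Lemma q_reassoc (a b1 b2 c : nat) : ((a * b1) * (b2 * c) = a * (b1 * b2) * c)%N.
Proof. by rewrite !mulnA. Qed.

(* the global state q_tau = tau_AB1 (x) tau_B2C, on H_A (x) (H_B1 (x) H_B2) (x) H_C *)
Definition q_tau dA dB1 dB2 dC (tAB1 : 'M[C]_(dA * dB1)) (tB2C : 'M[C]_(dB2 * dC))
  : 'M[C]_(dA * (dB1 * dB2) * dC) :=
  castmx (q_reassoc dA dB1 dB2 dC, q_reassoc dA dB1 dB2 dC) (q_tens tAB1 tB2C).

(* 1_A (x) B (x) 1_C *)
Definition q_embB dA dB1 dB2 dC (B : 'M[C]_(dB1 * dB2)) : 'M[C]_(dA * (dB1 * dB2) * dC) :=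
  q_tens (q_tens (1%:M : 'M[C]_dA) B) (1%:M : 'M[C]_dC).

(* p_b and q_tau^b_AC *)
Definition q_prob dA dB1 dB2 dC (tAB1 : 'M[C]_(dA * dB1)) (tB2C : 'M[C]_(dB2 * dC))
  (B : 'M[C]_(dB1 * dB2)) : C :=
  \tr (q_embB dA dC B *m q_tau tAB1 tB2C).

Definition q_post dA dB1 dB2 dC (tAB1 : 'M[C]_(dA * dB1)) (tB2C : 'M[C]_(dB2 * dC))
  (B : 'M[C]_(dB1 * dB2)) : 'M[C]_(dA * dC) :=
  (q_prob tAB1 tB2C B)^-1 *: q_ptrace_mid (q_embB dA dC B *m q_tau tAB1 tB2C).

End QDefs.

(* Main.v *)
(** Write tau_AB1, tau_B2C and B^b as sums of rank-one operators, whose vectors are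
    viewed as matrices g, g', h.  The unnormalised post-measurement state of outcome
    b is then the sum of the rank-one operators of the matrices x = g h g', and an
    operator M (x) N acts on x as M x N^T.  The sum-of-squares form of Tsirelson's
    bound gives A0 x = s x z and A1 x = t x w with z = (C0 + C1)^T / sqrt 2,
    w = (C0 - C1)^T / sqrt 2 and signs s, t depending on b.  Since z and w
    anticommute, the swap operators V_k on A and U_m on C satisfy
    V_k x U_m^T = c_b(k, m) r with c_b the amplitudes of the b-th Bell vector.

    Composing the g with the V_k, and the g' with the U_m, gives Kraus operators of
    two completely positive maps whose tensor product sends B^b to a positive
    multiple q_b of the b-th Bell projector.  Summing over b, the tensor product of
    their values at 1 is a positive combination of Bell projectors; this forces both
    values to be scalar and all q_b to be equal, so a rescaling makes the maps unital
    and the multiples 1. *)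
Require Import Defs.
From HB Require Import structures.
From mathcomp Require Import all_boot all_order all_algebra.
From mathcomp Require Import spectral ring.
Set Implicit Arguments. Unset Strict Implicit. Unset Printing Implicit Defensive.
Import Order.TTheory GRing.Theory Num.Theory.
Local Open Scope ring_scope.

Lemma index_allpairs (S T : eqType) (s : seq S) (t : seq T) x y :
  x \in s -> y \in t ->
  index (x, y) [seq (a, b) | a <- s, b <- t] = (index x s * size t + index y t)%N.
Proof.
move=> + yt; elim: s => //= z s IHs; rewrite inE index_cat eq_sym.
have [->|nzx] /= := eqVneq z x.
  move=> _; rewrite map_f // index_map //.
  by move=> ? ? [].
move=> xs; rewrite ifF; last first.
  by apply/mapP => -[w _ [e _]]; rewrite e eqxx in nzx.
by rewrite IHs // size_map mulSn addnA.
Qed.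

Lemma mxvec_index_val m n (i : 'I_m) (j : 'I_n) :
  mxvec_index i j = (i * n + j)%N :> nat.
Proof.
rewrite /mxvec_index /= /enum_rank enum_rank_in.unlock insubdK; last first.
  by rewrite -topredE /= cardE index_mem mem_enum.
rewrite enumT unlock /= index_allpairs ?mem_enum //.
by rewrite !index_enum_ord size_enum_ord.
Qed.

Lemma q_isplitK m n (i : 'I_m) (j : 'I_n) : q_isplit (mxvec_index i j) = (i, j).
Proof. by rewrite /q_isplit /mxvec_index cast_ordK enum_rankK. Qed.

Lemma big_mxvec_index (R : nmodType) m n (F : 'I_(m * n) -> R) :
  \sum_k F k = \sum_i \sum_j F (mxvec_index i j).
Proof.
by rewrite pair_big (reindex _ (curry_mxvec_bij _ _)) /=; apply: eq_bigr => -[].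
Qed.

Lemma exchange_big4 (R : nmodType) (I J K L S : finType)
    (F : I -> J -> K -> L -> S -> R) :
  \sum_i \sum_j \sum_k \sum_l \sum_s F i j k l s =
  \sum_s \sum_i \sum_j \sum_k \sum_l F i j k l s.
Proof.
rewrite [RHS]exchange_big; apply: eq_bigr => i _.
rewrite [RHS]exchange_big; apply: eq_bigr => j _.
rewrite [RHS]exchange_big; apply: eq_bigr => k _.
by rewrite exchange_big.
Qed.

Section BellSelfTest.
Variable C : numClosedFieldType.

Lemma q_adjE m n (M : 'M[C]_(m, n)) i j : q_adj M i j = (M j i)^*.
Proof. by rewrite !mxE. Qed.

Lemma q_adjK m n (M : 'M[C]_(m, n)) : q_adj (q_adj M) = M.
Proof. by apply/matrixP => i j; rewrite !q_adjE conjCK. Qed.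

Lemma q_adjM m n p (M : 'M[C]_(m, n)) (N : 'M_(n, p)) :
  q_adj (M *m N) = q_adj N *m q_adj M.
Proof. by rewrite /q_adj map_mxM trmx_mul. Qed.

Lemma q_adjD m n (M N : 'M[C]_(m, n)) : q_adj (M + N) = q_adj M + q_adj N.
Proof. by rewrite /q_adj map_mxD linearD. Qed.

Lemma q_adjB m n (M N : 'M[C]_(m, n)) : q_adj (M - N) = q_adj M - q_adj N.
Proof. by rewrite /q_adj map_mxB linearB. Qed.

Lemma q_adjZ m n a (M : 'M[C]_(m, n)) : q_adj (a *: M) = a^* *: q_adj M.
Proof. by rewrite /q_adj map_mxZ linearZ. Qed.

Lemma q_adj_tr m n (M : 'M[C]_(m, n)) : q_adj M^T = (q_adj M)^T.
Proof. by apply/matrixP => i j; rewrite !mxE. Qed.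

Lemma mxtrace_adj_mul m n (M : 'M[C]_(m, n)) :
  \tr (q_adj M *m M) = \sum_i \sum_j `|M i j| ^+ 2.
Proof.
rewrite exchange_big; apply: eq_bigr => j _; rewrite mxE; apply: eq_bigr => i _.
by rewrite q_adjE normCK mulrC.
Qed.

Lemma mxtrace_adj_mul_ge0 m n (M : 'M[C]_(m, n)) : 0 <= \tr (q_adj M *m M).
Proof.
by rewrite mxtrace_adj_mul; do 2 apply: sumr_ge0 => ? _; rewrite exprn_ge0.
Qed.

Lemma mxtrace_adj_mul_eq0 m n (M : 'M[C]_(m, n)) : \tr (q_adj M *m M) = 0 -> M = 0.
Proof.
rewrite mxtrace_adj_mul => /eqP; rewrite psumr_eq0 => [/allP M0|i _]; last first.
  by apply: sumr_ge0 => j _; rewrite exprn_ge0.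
apply/matrixP => i j; rewrite mxE.
have /(_ i (mem_index_enum _)) := M0; rewrite psumr_eq0 => [/allP Mi0|k _]; last first.
  by rewrite exprn_ge0.
by have := Mi0 j (mem_index_enum _); rewrite expf_eq0 /= normr_eq0 => /eqP.
Qed.

Lemma mulmx_adj_delta n (M : 'M[C]_n) i j :
  (q_adj (delta_mx i 0 : 'cV_n) *m M *m (delta_mx j 0 : 'cV_n)) 0 0 = M i j.
Proof.
have -> : q_adj (delta_mx i 0 : 'cV[C]_n) = delta_mx 0 i.
  by apply/matrixP => k l; rewrite q_adjE !mxE andbC conjC_nat.
by rewrite -rowE -colE !mxE.
Qed.

(* Polarization: the diagonal values v^* M v determine M. *)
Lemma q_psd_hermitian n (M : 'M[C]_n) : q_psd M -> q_hermitian M.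
Proof.
move=> psdM; pose D := q_adj M - M.
have D0 (v : 'cV_n) : (q_adj v *m D *m v) 0 0 = 0.
  have -> : q_adj v *m D *m v = q_adj (q_adj v *m M *m v) - q_adj v *m M *m v.
    by rewrite !q_adjM q_adjK mulmxBr mulmxBl mulmxA.
  by rewrite [LHS]mxE [X in _ + X]mxE q_adjE geC0_conj ?subrr.
apply/eqP; rewrite -subr_eq0; apply/eqP/matrixP => i j; rewrite [RHS]mxE -/D.
move: D D0 => D D0.
pose e k : 'cV[C]_n := delta_mx k 0.
have pol (a : C) : a * D i j + a^* * D j i = 0.
  have := D0 (e i + a *: e j).
  have addE (N P : 'M[C]_1) : (N + P) 0 0 = N 0 0 + P 0 0 by rewrite mxE.
  have scaleE b (N : 'M[C]_1) : (b *: N) 0 0 = b * N 0 0 by rewrite mxE.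
  have E k l : (q_adj (e k) *m D *m e l) 0 0 = D k l by apply: mulmx_adj_delta.
  have Ed k : D k k = 0 by rewrite -E D0.
  rewrite q_adjD q_adjZ !(mulmxDl, mulmxDr, =^~ scalemxAl, =^~ scalemxAr).
  by rewrite !(addE, scaleE, E, Ed, mulr0, add0r, addr0) addrC.
have := pol 1; have := pol 'i; rewrite conjCi conjC1 !mul1r mulNr -mulrBr => /eqP.
rewrite mulf_eq0 (negPf (neq0Ci _)) /= subr_eq0 => /eqP ->  /eqP.
by rewrite -mulr2n mulrn_eq0 /= => /eqP.
Qed.

Lemma q_psd_factor n (M : 'M[C]_n) : q_psd M -> exists G : 'M_n, M = G *m q_adj G.
Proof.
move=> psdM; have hM := q_psd_hermitian psdM.
have adjE k l (N : 'M[C]_(k, l)) : map_mx Num.conj N^T = q_adj N.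
  by apply/matrixP => i j; rewrite !mxE.
have nM : M \is normalmx by apply/normalmxP; rewrite !adjE hM.
have uP := spectral_unitarymx M; have /orthomx_spectralP ME := nM.
rewrite (invmx_unitary uP) adjE in ME.
set P := spectralmx M in uP ME; set d := spectral_diag M in ME.
have PP : P *m q_adj P = 1%:M by rewrite -adjE; apply/unitarymxP.
have d_ge0 i : 0 <= d 0 i.
  have := psdM (q_adj P *m delta_mx i 0).
  rewrite ME q_adjM q_adjK !mulmxA -(mulmxA (q_adj _) P) PP mulmx1.
  rewrite -[X in X *m delta_mx _ _]mulmxA PP mulmx1 mulmx_adj_delta.
  by rewrite mxE eqxx mulr1n.
exists (q_adj P *m diag_mx (map_mx sqrtC d)).
rewrite [LHS]ME q_adjM q_adjK !mulmxA; congr (_ *m _); rewrite -!mulmxA; congr (_ *m _).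
have -> : q_adj (diag_mx (map_mx sqrtC d)) = diag_mx (map_mx sqrtC d).
  apply/matrixP => i j; rewrite q_adjE !mxE eq_sym; case: eqP => [->|_]; last by rewrite conjC0.
  by rewrite mulr1n geC0_conj // sqrtC_ge0.
rewrite mulmx_diag; congr diag_mx; apply/rowP => i; rewrite !mxE -expr2 sqrtCK.
by [].
Qed.

(* Vectors of a tensor product are encoded as matrices [g s]. *)
Lemma q_psd_tensor_factor m n (M : 'M[C]_(m * n)) : q_psd M ->
  exists g : 'I_(m * n) -> 'M[C]_(m, n), forall i j k l,
    M (mxvec_index i j) (mxvec_index k l) = \sum_s g s i j * (g s k l)^*.
Proof.
move=> /q_psd_factor[G ->].
exists (fun s => \matrix_(i, j) G (mxvec_index i j) s) => i j k l.
by rewrite mxE; apply: eq_bigr => s _; rewrite q_adjE !mxE.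
Qed.

Lemma q_adj_sum I r (P : pred I) m n (F : I -> 'M[C]_(m, n)) :
  q_adj (\sum_(i <- r | P i) F i) = \sum_(i <- r | P i) q_adj (F i).
Proof.
apply: (big_morph (@q_adj C m n) (@q_adjD m n)).
by rewrite /q_adj map_mx0 trmx0.
Qed.

Lemma q_tensE m1 n1 m2 n2 (A : 'M[C]_(m1, n1)) (B : 'M[C]_(m2, n2)) i k j l :
  q_tens A B (mxvec_index i k) (mxvec_index j l) = A i j * B k l.
Proof. by rewrite mxE !q_isplitK. Qed.

Lemma mxvec_index_inj m n (i k : 'I_m) (j l : 'I_n) :
  mxvec_index i j = mxvec_index k l -> i = k /\ j = l.
Proof. by move=> /(congr1 (@q_isplit m n)); rewrite !q_isplitK => -[]. Qed.

Lemma q_tensmapE n1 m1 n2 m2 (f : 'M[C]_n1 -> 'M[C]_m1) (g : 'M[C]_n2 -> 'M[C]_m2)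
    X p r q s :
  q_tensmap f g X (mxvec_index p r) (mxvec_index q s) =
  \sum_i \sum_j \sum_k \sum_l X (mxvec_index i k) (mxvec_index j l) *
    (f (delta_mx i j) p q * g (delta_mx k l) r s).
Proof.
rewrite summxE; apply: eq_bigr => i _; rewrite summxE; apply: eq_bigr => j _.
rewrite summxE; apply: eq_bigr => k _; rewrite summxE; apply: eq_bigr => l _.
by rewrite [LHS]mxE q_tensE.
Qed.

Lemma quadratic_formE m n (M : 'M[C]_(m * n)) (v w : 'cV[C]_(m * n)) :
  (q_adj v *m M *m w) 0 0 = \sum_k \sum_l \sum_i \sum_j
    (v (mxvec_index k i) 0)^* * M (mxvec_index k i) (mxvec_index l j) *
    w (mxvec_index l j) 0.
Proof.
transitivity (\sum_k \sum_i \sum_l \sum_j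
    (v (mxvec_index k i) 0)^* * M (mxvec_index k i) (mxvec_index l j) *
    w (mxvec_index l j) 0); last first.
  by apply: eq_bigr => k _; rewrite exchange_big.
rewrite -mulmxA mxE big_mxvec_index; apply: eq_bigr => k _; apply: eq_bigr => i _.
rewrite q_adjE mxE big_mxvec_index mulr_sumr; apply: eq_bigr => l _.
by rewrite mulr_sumr; apply: eq_bigr => j _; rewrite mulrA.
Qed.

Section KrausMap.
Variables (S : finType) (n m h : nat) (K : S -> 'I_m -> 'M[C]_(n, h)).

Definition kraus_map (X : 'M[C]_n) : 'M[C]_m :=
  \matrix_(i, j) \sum_s \tr (q_adj (K s i) *m X *m K s j).

Lemma kraus_map_lin : q_lin kraus_map.
Proof.
move=> a X Y; apply/matrixP => i j; rewrite !mxE mulr_sumr -big_split /=.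
apply: eq_bigr => s _.
by rewrite mulmxDr mulmxDl mxtraceD -scalemxAr -scalemxAl mxtraceZ.
Qed.

Lemma kraus_map_sum I r (F : I -> 'M[C]_n) :
  kraus_map (\sum_(i <- r) F i) = \sum_(i <- r) kraus_map (F i).
Proof.
have D X Y : kraus_map (X + Y) = kraus_map X + kraus_map Y.
  by rewrite -{1}[X]scale1r kraus_map_lin scale1r.
apply: (big_morph _ D); apply: (addrI (kraus_map 0)).
by rewrite -D !addr0.
Qed.

Lemma kraus_map_delta i j k l :
  kraus_map (delta_mx i j) k l = \sum_s (K s l *m q_adj (K s k)) j i.
Proof.
rewrite mxE; apply: eq_bigr => s _.
rewrite mxtrace_mulC mulmxA /mxtrace (bigD1 j) //= big1 => [|t /negPf tj].
  rewrite addr0 mxE (bigD1 i) //= big1 => [|t /negPf ti].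
    by rewrite !mxE !eqxx mulr1 addr0.
  by rewrite [delta_mx _ _ _ _]mxE ti mulr0.
by rewrite mxE big1 // => u _; rewrite [delta_mx _ _ _ _]mxE tj andbF mulr0.
Qed.

Lemma kraus_mapZ a X : kraus_map (a *: X) = a *: kraus_map X.
Proof.
apply/matrixP => i j; rewrite !mxE mulr_sumr; apply: eq_bigr => s _.
by rewrite -scalemxAr -scalemxAl mxtraceZ.
Qed.

Lemma q_tensmap_id_kraus k (X : 'M[C]_(k * n)) p q i j :
  q_tensmap id kraus_map X (mxvec_index p i) (mxvec_index q j) =
  kraus_map (\matrix_(c, d) X (mxvec_index p c) (mxvec_index q d)) i j.
Proof.
rewrite q_tensmapE (bigD1 p) //= [X in _ + X]big1 => [|a /negPf ap]; last first.
  rewrite big1 // => b _; rewrite big1 // => c _; rewrite big1 // => d _.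
  by rewrite mxE eq_sym ap mul0r mulr0.
rewrite addr0 (bigD1 q) //= [X in _ + X]big1 => [|b /negPf bq]; last first.
  rewrite big1 // => c _; rewrite big1 // => d _.
  by rewrite mxE [q == b]eq_sym bq andbF mul0r mulr0.
rewrite addr0 [X in kraus_map X]matrix_sum_delta kraus_map_sum summxE.
apply: eq_bigr => c _; rewrite kraus_map_sum summxE; apply: eq_bigr => d _.
by rewrite kraus_mapZ [RHS]mxE !mxE !eqxx mul1r.
Qed.
Lemma kraus_map_cp : q_cp kraus_map.
Proof.
move=> k X psdX v.
pose y s t : 'cV[C]_(k * n) :=
  \col_x \sum_j v (mxvec_index (q_isplit x).1 j) 0 * K s j (q_isplit x).2 t.
have -> : (q_adj v *m q_tensmap id kraus_map X *m v) 0 0 =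
    \sum_s \sum_t (q_adj (y s t) *m X *m y s t) 0 0.
  under [RHS]eq_bigr => s _ do under eq_bigr => t _ do rewrite quadratic_formE.
  under [RHS]eq_bigr => s _ do (rewrite exchange_big; under eq_bigr => p _ do rewrite exchange_big).
  rewrite quadratic_formE [RHS]exchange_big; apply: eq_bigr => p _.
  rewrite [RHS]exchange_big; apply: eq_bigr => q _.
  set Xpq := \matrix_(c, d) X (mxvec_index p c) (mxvec_index q d).
  pose Y r s := \sum_i v (mxvec_index r i) 0 *: K s i.
  transitivity (\sum_s \tr (q_adj (Y p s) *m Xpq *m Y q s)).
    under eq_bigr => i _ do under eq_bigr => j _ do
      rewrite q_tensmap_id_kraus -/Xpq [kraus_map _ _ _]mxE mulr_sumr mulr_suml.
    under eq_bigr => i _ do rewrite exchange_big.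
    rewrite exchange_big; apply: eq_bigr => s _.
    rewrite /Y q_adj_sum !mulmx_suml linear_sum; apply: eq_bigr => i _.
    rewrite mulmx_sumr linear_sum; apply: eq_bigr => j _.
    rewrite /= q_adjZ -!scalemxAl -scalemxAr !mxtraceZ.
    by rewrite -!mulrA; congr (_ * _); rewrite mulrC.
  apply: eq_bigr => s _; apply: eq_bigr => t _.
  have yE r c : y s t (mxvec_index r c) 0 = Y r s c t.
    by rewrite mxE q_isplitK summxE; apply: eq_bigr => j _; rewrite mxE.
  rewrite -mulmxA mxE; apply: eq_bigr => c _; rewrite [(Xpq *m _) _ _]mxE mulr_sumr.
  apply: eq_bigr => d _.
  by rewrite q_adjE !yE mxE mulrA.
by do 2 apply: sumr_ge0 => ? _; apply: psdX.
Qed.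
End KrausMap.

Lemma mxtrace_mul4 m n p q (M : 'M[C]_(m, n)) (N : 'M_(n, p)) (P : 'M_(p, q))
    (Q : 'M_(q, m)) :
  \tr (M *m N *m P *m Q) = \sum_i \sum_j \sum_k \sum_l M i j * (N j l * P l k) * Q k i.
Proof.
apply: eq_bigr => i _; rewrite -(mulmxA M) -(mulmxA M) mxE; apply: eq_bigr => j _.
rewrite [(N *m P *m Q) _ _]mxE mulr_sumr; apply: eq_bigr => k _.
by rewrite mxE mulrA mulr_sumr mulr_suml.
Qed.

Lemma q_tensmap_kraus (S S' : finType) n1 n2 m1 m2 h1 h2
    (K : S -> 'I_m1 -> 'M[C]_(n1, h1)) (K' : S' -> 'I_m2 -> 'M[C]_(n2, h2))
    (Q : finType) (X : 'M[C]_(n1 * n2)) (b : Q -> 'M[C]_(n1, n2)) :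
  (forall i k j l, X (mxvec_index i k) (mxvec_index j l) =
                   \sum_q (b q i k)^* * b q j l) ->
  forall p r q s,
  q_tensmap (kraus_map K) (kraus_map K') X (mxvec_index p r) (mxvec_index q s) =
  \sum_x \sum_y \sum_z
    \tr (q_adj ((K y p)^T *m b x *m K' z r) *m ((K y q)^T *m b x *m K' z s)).
Proof.
move=> XE p r q s; rewrite q_tensmapE.
pose N := \sum_y K y q *m q_adj (K y p).
pose N' := \sum_z K' z s *m q_adj (K' z r).
have NE i j : kraus_map K (delta_mx i j) p q = N j i.
  by rewrite kraus_map_delta summxE.
have NE' i j : kraus_map K' (delta_mx i j) r s = N' j i.
  by rewrite kraus_map_delta summxE.
under eq_bigr => i _ do under eq_bigr => j _ do under eq_bigr => k _ do
  under eq_bigr => l _ do rewrite XE NE NE' mulr_suml.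
rewrite exchange_big4; apply: eq_bigr => x _.
transitivity (\tr (N^T *m b x *m N' *m q_adj (b x))).
  rewrite mxtrace_mul4; apply: eq_bigr => i _; apply: eq_bigr => j _.
  apply: eq_bigr => k _; apply: eq_bigr => l _.
  rewrite q_adjE [N^T _ _]mxE; ring.
have -> : N^T = \sum_y (K y q *m q_adj (K y p))^T by rewrite linear_sum.
rewrite !mulmx_suml (linear_sum mxtrace); apply: eq_bigr => y _ /=.
rewrite mulmx_sumr mulmx_suml (linear_sum mxtrace); apply: eq_bigr => z _ /=.
rewrite [RHS]mxtrace_mulC !q_adjM trmx_mul q_adj_tr -!mulmxA.
by rewrite [LHS]mxtrace_mulC !mulmxA.
Qed.

Lemma q_tauE dA dB1 dB2 dC (t1 : 'M[C]_(dA * dB1)) (t2 : 'M[C]_(dB2 * dC))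
    a b1 b2 c a' b1' b2' c' :
  q_tau t1 t2 (mxvec_index (mxvec_index a (mxvec_index b1 b2)) c)
              (mxvec_index (mxvec_index a' (mxvec_index b1' b2')) c') =
  t1 (mxvec_index a b1) (mxvec_index a' b1') *
  t2 (mxvec_index b2 c) (mxvec_index b2' c').
Proof.
have reE x y1 y2 z : cast_ord (esym (q_reassoc dA dB1 dB2 dC))
    (mxvec_index (mxvec_index x (mxvec_index y1 y2)) z) =
    mxvec_index (mxvec_index x y1) (mxvec_index y2 z).
  apply/ord_inj; transitivity (nat_of_ord (mxvec_index (mxvec_index x (mxvec_index y1 y2)) z)).
    by [].
  by rewrite !mxvec_index_val !(mulnDl, mulnA, addnA).
by rewrite castmxE !reE q_tensE.
Qed.

Lemma q_ptrace_mid_outer_sum dA dB1 dB2 dC (t1 : 'M[C]_(dA * dB1)) (t2 : 'M[C]_(dB2 * dC))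
    (B : 'M[C]_(dB1 * dB2)) (S S' Q : finType) (g : S -> 'M[C]_(dA, dB1))
    (g' : S' -> 'M[C]_(dB2, dC)) (b : Q -> 'M[C]_(dB1, dB2)) :
  (forall i j k l, t1 (mxvec_index i j) (mxvec_index k l) = \sum_s g s i j * (g s k l)^*) ->
  (forall i j k l, t2 (mxvec_index i j) (mxvec_index k l) = \sum_s g' s i j * (g' s k l)^*) ->
  (forall i k j l, B (mxvec_index i k) (mxvec_index j l) = \sum_q (b q i k)^* * b q j l) ->
  forall a c a' c',
  q_ptrace_mid (q_embB dA dC B *m q_tau t1 t2) (mxvec_index a c) (mxvec_index a' c') =
  \sum_x \sum_y \sum_z (g y *m b x *m g' z) a c * ((g y *m b x *m g' z) a' c')^*.
Proof.
move=> t1E t2E BE a c a' c'.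
transitivity (\sum_i \sum_j \sum_k \sum_l B (mxvec_index i k) (mxvec_index j l) *
    (t1 (mxvec_index a j) (mxvec_index a' i) * t2 (mxvec_index l c) (mxvec_index k c'))).
  rewrite mxE !q_isplitK /= big_mxvec_index; apply: eq_bigr => i _.
  rewrite exchange_big; apply: eq_bigr => k _.
  rewrite mxE big_mxvec_index big_mxvec_index (bigD1 a) //= [X in _ + X]big1; last first.
    move=> d /negPf da; rewrite big1 // => e _; rewrite big1 // => f _.
    by rewrite !q_tensE mxE eq_sym da !mul0r.
  rewrite addr0 big_mxvec_index; apply: eq_bigr => j _; apply: eq_bigr => l _.
  rewrite (bigD1 c) //= [X in _ + X]big1 => [|d /negPf dc]; last first.
    by rewrite !q_tensE [in X in _ * X * _]mxE eq_sym dc mulr0 mul0r.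
  by rewrite addr0 !q_tensE q_tauE !mxE !eqxx mul1r mulr1.
have xE x y z d e : (g y *m b x *m g' z) d e = \sum_i \sum_k g y d i * b x i k * g' z k e.
  rewrite mxE exchange_big; apply: eq_bigr => k _; rewrite mxE mulr_suml.
  by apply: eq_bigr.
under eq_bigr => i _ do under eq_bigr => j _ do under eq_bigr => k _ do
  under eq_bigr => l _ do rewrite t1E t2E BE mulr_suml.
rewrite exchange_big4; apply: eq_bigr => x _ /=.
under eq_bigr => i _ do under eq_bigr => j _ do under eq_bigr => k _ do
  under eq_bigr => l _ do rewrite mulr_suml mulr_sumr.
rewrite exchange_big4; apply: eq_bigr => y _ /=.
under eq_bigr => i _ do under eq_bigr => j _ do under eq_bigr => k _ do
  under eq_bigr => l _ do rewrite mulr_sumr mulr_sumr.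
rewrite exchange_big4; apply: eq_bigr => z _ /=.
rewrite !xE rmorph_sum mulr_sumr; apply: eq_bigr => i _.
rewrite mulr_suml; apply: eq_bigr => j _.
rewrite rmorph_sum mulr_sumr; apply: eq_bigr => k _.
rewrite mulr_suml; apply: eq_bigr => l _.
rewrite !rmorphM /=; ring.
Qed.

Lemma trace_q_tens_mul m n (M : 'M[C]_m) (N : 'M[C]_n) (S : 'M[C]_(m * n))
    (X : finType) (x : X -> 'M[C]_(m, n)) :
  (forall i j k l, S (mxvec_index i j) (mxvec_index k l) = \sum_s x s i j * (x s k l)^*) ->
  \tr (q_tens M N *m S) = \sum_s \tr (q_adj (x s) *m (M *m x s *m N^T)).
Proof.
move=> SE; rewrite /mxtrace big_mxvec_index.
under eq_bigr => i _ do under eq_bigr => j _ do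
  rewrite mxE big_mxvec_index.
under eq_bigr => i _ do under eq_bigr => j _ do under eq_bigr => k _ do
  under eq_bigr => l _ do rewrite q_tensE SE mulr_sumr.
rewrite exchange_big4; apply: eq_bigr => s _ /=.
rewrite exchange_big; apply: eq_bigr => j _; rewrite mxE; apply: eq_bigr => i _.
rewrite q_adjE mxE mulr_sumr exchange_big; apply: eq_bigr => l _.
rewrite [(M *m _) _ _]mxE mulr_suml mulr_sumr; apply: eq_bigr => k _.
by rewrite [N^T _ _]mxE; ring.
Qed.

Lemma q_tensmap1_kraus (S S' : finType) n1 n2 m1 m2 h1 h2
    (K : S -> 'I_m1 -> 'M[C]_(n1, h1)) (K' : S' -> 'I_m2 -> 'M[C]_(n2, h2)) p r q s :
  q_tensmap (kraus_map K) (kraus_map K') 1%:M (mxvec_index p r) (mxvec_index q s) =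
  kraus_map K 1%:M p q * kraus_map K' 1%:M r s.
Proof.
rewrite q_tensmapE.
have E m n h (T : finType) (H : T -> 'I_m -> 'M[C]_(n, h)) i j :
    kraus_map H 1%:M i j = \sum_k kraus_map H (delta_mx k k) i j.
  by rewrite -summxE -kraus_map_sum mx1_sum_delta.
rewrite !E mulr_suml; apply: eq_bigr => i _.
rewrite (bigD1 i) //= [X in _ + X]big1 => [|j /negPf ji]; last first.
  rewrite big1 // => k _; rewrite big1 // => l _.
  rewrite [_%:M _ _]mxE; case: eqP => [/mxvec_index_inj[ij _]|]; last by rewrite mul0r.
  by rewrite ij eqxx in ji.
rewrite addr0 mulr_sumr; apply: eq_bigr => k _.
rewrite (bigD1 k) //= [X in _ + X]big1 => [|l /negPf lk]; last first.
  rewrite [_%:M _ _]mxE; case: eqP => [/mxvec_index_inj[_ kl]|]; last by rewrite mul0r.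
  by rewrite kl eqxx in lk.
by rewrite addr0 [_%:M _ _]mxE eqxx mul1r.
Qed.

Lemma q_tensmap_sum n1 m1 n2 m2 (f : 'M[C]_n1 -> 'M[C]_m1) (g : 'M[C]_n2 -> 'M[C]_m2)
    (I : finType) (F : I -> 'M[C]_(n1 * n2)) :
  q_tensmap f g (\sum_b F b) = \sum_b q_tensmap f g (F b).
Proof.
rewrite -exchange_big4; apply: eq_bigr => i _; apply: eq_bigr => j _.
apply: eq_bigr => k _; apply: eq_bigr => l _.
by rewrite summxE scaler_suml.
Qed.

Lemma kraus_map_scale (S : finType) n m h (K : S -> 'I_m -> 'M[C]_(n, h)) a X :
  kraus_map (fun s i => a *: K s i) X = (a^* * a) *: kraus_map K X.
Proof.
apply/matrixP => i j; rewrite !mxE mulr_sumr; apply: eq_bigr => s _.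
by rewrite q_adjZ -!scalemxAl -scalemxAr !mxtraceZ mulrA.
Qed.

Lemma q_tensmap_kraus_scale (S S' : finType) n1 n2 m1 m2 h1 h2
    (K : S -> 'I_m1 -> 'M[C]_(n1, h1)) (K' : S' -> 'I_m2 -> 'M[C]_(n2, h2)) a a' X :
  q_tensmap (kraus_map (fun s i => a *: K s i)) (kraus_map (fun s i => a' *: K' s i)) X =
  (a^* * a * (a'^* * a')) *: q_tensmap (kraus_map K) (kraus_map K') X.
Proof.
rewrite /q_tensmap; do 4 (rewrite scaler_sumr; apply: eq_bigr => ? _).
have tensZ c c' (M : 'M_m1) (N : 'M_m2) : q_tens (c *: M) (c' *: N) = (c * c') *: q_tens M N.
  by apply/matrixP => i j; rewrite !mxE mulrACA.
by rewrite !kraus_map_scale tensZ !scalerA mulrC.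
Qed.

Lemma mxtrace_ptrace_mid m n k (Y : 'M[C]_(m * n * k)) : \tr (q_ptrace_mid Y) = \tr Y.
Proof.
rewrite /mxtrace !big_mxvec_index; apply: eq_bigr => i _.
rewrite exchange_big; apply: eq_bigr => l _.
by rewrite mxE !q_isplitK.
Qed.

(* The two components of the swap isometry, up to a factor 2, for which [A0] and
   [A1] play the roles of the Pauli matrices Z and X. *)
Definition swap_left d (A0 A1 : 'M[C]_d) (k : 'I_2) : 'M[C]_d :=
  if k == 0 then 1%:M + A0 else A1 *m (1%:M - A0).

(* The same operators on the other party, transposed: a vector of the tensor
   product is a matrix, on which the second factor acts by right multiplication
   with the transpose. *)
Definition swap_right d (z w : 'M[C]_d) (k : 'I_2) : 'M[C]_d :=
  if k == 0 then 1%:M + z else (1%:M - z) *m w.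

(* [W_b = sqrt 2 (bell_sz b * ZZ + bell_sx b * XX)], and [bell_coef b k m] is
   [sqrt 2] times the amplitude of the b-th Bell vector at |km>. *)
Definition bell_sz (b : 'I_4) : C := if (b < 2)%N then 1 else -1.
Definition bell_sx (b : 'I_4) : C := if odd b then -1 else 1.
Definition bell_coef (b : 'I_4) (k m : 'I_2) : C :=
  if (k == m) == (b < 2)%N then (if k == 0 then 1 else bell_sx b) else 0.

Lemma bell_sz_sqr b : bell_sz b * bell_sz b = 1.
Proof. by rewrite /bell_sz; case: ifP; rewrite ?mulrNN mulr1. Qed.

Lemma bell_sx_sqr b : bell_sx b * bell_sx b = 1.
Proof. by rewrite /bell_sx; case: ifP; rewrite ?mulrNN mulr1. Qed.

Lemma bell_sx_neq0 b : bell_sx b != 0.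
Proof. by rewrite /bell_sx; case: (odd b); rewrite ?oppr_eq0 oner_eq0. Qed.

Lemma bell_sz_conj b : (bell_sz b)^* = bell_sz b.
Proof. by rewrite /bell_sz; case: ifP; rewrite ?rmorphN /= conjC1. Qed.

Lemma bell_sx_conj b : (bell_sx b)^* = bell_sx b.
Proof. by rewrite /bell_sx; case: (odd b); rewrite ?rmorphN /= conjC1. Qed.

Lemma bell_coef_conj b k m : (bell_coef b k m)^* = bell_coef b k m.
Proof.
by rewrite /bell_coef; case: ifP => _; [case: ifP|]; rewrite ?bell_sx_conj ?conjC0 ?conjC1.
Qed.

Lemma q_bellE b k m l n :
  q_bell C b (mxvec_index k m) (mxvec_index l n) =
  2^-1 * (bell_coef b k m * bell_coef b l n).
Proof.
have vE i j : q_bell_vec C b (mxvec_index i j) 0 = (sqrtC 2)^-1 * bell_coef b i j.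
  have kE p r : q_ket2 C p r (mxvec_index i j) 0 = ((i == p) && (j == r))%:R.
    by rewrite mxE !q_isplitK !mxE /= !ord1 !eqxx !andbT -natrM mulnb.
  have kNE p r : (- q_ket2 C p r) (mxvec_index i j) 0 = - ((i == p) && (j == r))%:R.
    by rewrite [LHS]mxE kE.
  rewrite mxE; congr (_ * _).
  rewrite /bell_coef /bell_sx.
  case: b => -[|[|[|[|//]]]] ? /=; rewrite mxE !(kNE, kE);
  move: i j {kE kNE} => [[|[|//]] ?] [[|[|//]] ?] /=;
  rewrite -?val_eqE /= ?oppr0 ?addr0 ?add0r ?expr1 ?expr0 //.
rewrite /q_bell [LHS]mxE big_ord1 q_adjE !vE rmorphM /=.
have -> : ((sqrtC 2)^-1)^* = (sqrtC 2 : C)^-1 by rewrite geC0_conj // invr_ge0 sqrtC_ge0 ler0n.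
by rewrite bell_coef_conj mulrACA -invfM -expr2 sqrtCK.
Qed.

Section Tsirelson.
Variables (dA dC : nat) (A0 A1 : 'M[C]_dA) (z w : 'M[C]_dC).
Hypotheses (hA0 : q_hermitian A0) (hA1 : q_hermitian A1).
Hypotheses (A0A0 : A0 *m A0 = 1%:M) (A1A1 : A1 *m A1 = 1%:M).
Hypotheses (hz : q_hermitian z) (hw : q_hermitian w).
Hypotheses (zw : z *m w = - (w *m z)) (zzww : z *m z + w *m w = 2%:M).

Lemma norm_diffE (A : 'M[C]_dA) (y : 'M[C]_dC) (x : 'M[C]_(dA, dC)) (s : C) :
  q_hermitian A -> A *m A = 1%:M -> q_hermitian y -> s * s = 1 -> s^* = s ->
  \tr (q_adj (A *m x - s *: (x *m y)) *m (A *m x - s *: (x *m y))) =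
  \tr (q_adj x *m x) - (s * \tr (q_adj x *m (A *m x *m y))) *+ 2 +
  \tr (q_adj x *m x *m (y *m y)).
Proof.
move=> hA AA hy ss sC.
rewrite q_adjB q_adjZ sC !q_adjM hA hy mulmxBl !mulmxBr -!scalemxAl -!scalemxAr.
rewrite scalerA ss scale1r !mulmxA -(mulmxA _ A A) AA mulmx1.
rewrite !(linearB mxtrace) /= !mxtraceZ.
have -> : \tr (y *m q_adj x *m A *m x) = \tr (q_adj x *m A *m x *m y).
  by rewrite -!mulmxA mxtrace_mulC !mulmxA.
have -> : \tr (y *m q_adj x *m x *m y) = \tr (q_adj x *m x *m y *m y).
  by rewrite -!mulmxA mxtrace_mulC !mulmxA.
ring.
Qed.

Lemma tsirelson_sos (x : 'M[C]_(dA, dC)) (s t : C) :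
  s * s = 1 -> s^* = s -> t * t = 1 -> t^* = t ->
  \tr (q_adj (A0 *m x - s *: (x *m z)) *m (A0 *m x - s *: (x *m z))) +
  \tr (q_adj (A1 *m x - t *: (x *m w)) *m (A1 *m x - t *: (x *m w))) =
  (\tr (q_adj x *m x) *+ 2 - s * \tr (q_adj x *m (A0 *m x *m z))
    - t * \tr (q_adj x *m (A1 *m x *m w))) *+ 2.
Proof.
move=> ss sC tt tC; rewrite !norm_diffE //.
have : \tr (q_adj x *m x *m (z *m z)) + \tr (q_adj x *m x *m (w *m w)) =
       \tr (q_adj x *m x) *+ 2.
  by rewrite -mxtraceD -mulmxDr zzww mul_mx_scalar mxtraceZ mulr_natl.
set a := \tr (_ *m (z *m z)); set b := \tr (_ *m (w *m w)) => ab.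
by rewrite addrACA ab; ring.
Qed.

Section SwapState.
Variables (x : 'M[C]_(dA, dC)) (b : 'I_4).
Hypotheses (xz : A0 *m x = bell_sz b *: (x *m z)).
Hypotheses (xw : A1 *m x = bell_sx b *: (x *m w)).

Definition swap_vec : 'M[C]_(dA, dC) :=
  if (b < 2)%N then x *m (1%:M + z) else x *m (1%:M - z) *m w.

Lemma mul_state_zz : x *m z *m z = x.
Proof.
have := congr1 (mulmx A0) xz; rewrite mulmxA A0A0 mul1mx -scalemxAr mulmxA xz -scalemxAl scalerA.
by rewrite bell_sz_sqr scale1r => <-.
Qed.

Lemma mul_state_ww : x *m w *m w = x.
Proof.
have := congr1 (mulmx A1) xw; rewrite mulmxA A1A1 mul1mx -scalemxAr mulmxA xw -scalemxAl scalerA.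
by rewrite bell_sx_sqr scale1r => <-.
Qed.

Lemma mul_state_wz : x *m w *m z = - (x *m z *m w).
Proof. by rewrite -!mulmxA zw mulmxN opprK. Qed.

Lemma mul_state_zww : x *m z *m w *m w = x *m z.
Proof.
rewrite -(mulmxA x) zw mulmxN mulNmx -mulmxA -mulmxA zw mulmxN mulmxN opprK.
by rewrite !mulmxA mul_state_ww.
Qed.

Lemma swap_vecE k m :
  swap_left A0 A1 k *m x *m swap_right z w m =
  (2 * bell_coef b k m) *: swap_vec.
Proof.
rewrite /swap_left /swap_right /bell_coef /swap_vec.
have := xz; have := xw; rewrite /bell_sz; set t := bell_sx b.
case: ifP => _ yw yz; move: k m => [[|[|//]] ?] [[|[|//]] ?]; rewrite -?val_eqE /=;
  rewrite ?mulr1 ?mulr0 ?scale0r ?mulmxA ?(mulmxDl, mulmxBl, mulmxDr, mulmxBr, mul1mx, mulmx1);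
  rewrite ?(yz, scale1r, scaleN1r, mulNmx, mulmxN) -?(mulmxA A1)
    ?(yz, scale1r, scaleN1r, mulNmx, mulmxN).
all: rewrite ?mul_state_zz ?mulmxA ?yw
  ?(=^~ scalemxAl, mul_state_zz, mul_state_ww, mul_state_zww, mul_state_wz, mulNmx).
all: move: (x *m z *m w) (x *m z) (x *m w) => x1 x2 x3.
all: by apply/matrixP => i j; rewrite !mxE; ring.
Qed.

Lemma swap_vec_eq0 : swap_vec = 0 -> x = 0.
Proof.
have neg0 (y : 'M[C]_(dA, dC)) : y = - y -> y = 0.
  move=> yN; apply/matrixP => i j; move/matrixP/(_ i j): yN; rewrite !mxE => /eqP.
  by rewrite -subr_eq0 opprK -mulr2n mulrn_eq0 => /eqP.
have step (s : C) : s * s = 1 -> x *m z = s *: x -> x = 0.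
  move=> ss xzs; suff xw0 : x *m w = 0 by rewrite -mul_state_ww xw0 mul0mx.
  have Axz : x *m w *m z = s *: (x *m w).
    apply: (scalerI (a := bell_sx b)); first exact: bell_sx_neq0.
    have <- : A1 *m x *m z = bell_sx b *: (x *m w *m z) by rewrite xw -scalemxAl.
    by rewrite -mulmxA xzs -scalemxAr xw !scalerA mulrC.
  apply: neg0.
  have := Axz; rewrite mul_state_wz xzs -scalemxAl.
  move/(congr1 (fun y => s *: y)); rewrite scalerN !scalerA ss !scale1r.
  by move/esym.
rewrite /swap_vec; case: ifP => _ r0.
  apply: (step (-1)); first by rewrite mulrNN mulr1.
  by apply/eqP; rewrite scaleN1r -addr_eq0 addrC -{1}[x]mulmx1 -mulmxDr r0.
apply: (step 1); first by rewrite mulr1.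
move/(congr1 (mulmx^~ w)): r0; rewrite mul0mx mulmxBr mulmx1 !mulmxBl mul_state_ww mul_state_zww.
by rewrite scale1r => /eqP; rewrite subr_eq0 => /eqP <-.
Qed.
End SwapState.
End Tsirelson.

Lemma trace_q_W dA dC (A0 A1 : 'M[C]_dA) (C0 C1 : 'M[C]_dC) (S : 'M[C]_(dA * dC))
    (X : finType) (x : X -> 'M[C]_(dA, dC)) b :
  (forall i j k l, S (mxvec_index i j) (mxvec_index k l) = \sum_s x s i j * (x s k l)^*) ->
  \tr (q_W A0 A1 C0 C1 b *m S) = \sum_s
    (bell_sz b * \tr (q_adj (x s) *m (A0 *m x s *m (C0 + C1)^T)) +
     bell_sx b * \tr (q_adj (x s) *m (A1 *m x s *m (C0 - C1)^T))).
Proof.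
move=> SE; pose F A D s := \tr (q_adj (x s) *m (A *m x s *m D^T)).
have FE A D : \tr (q_tens A D *m S) = \sum_s F A D s by apply: trace_q_tens_mul.
have FD A D D' s : \tr (q_adj (x s) *m (A *m x s *m (D + D')^T)) = F A D s + F A D' s.
  by rewrite linearD /= !mulmxDr mxtraceD.
have FB A D D' s : \tr (q_adj (x s) *m (A *m x s *m (D - D')^T)) = F A D s - F A D' s.
  by rewrite linearB /= !mulmxBr linearB.
under [RHS]eq_bigr => s _ do rewrite FD FB.
rewrite big_split /= -!mulr_sumr sumrB big_split /= -!FE.
rewrite /q_W /bell_sz /bell_sx.
case: b => -[|[|[|[|//]]]] ? /=;
  rewrite !(mulNmx, mulmxDl, mulmxBl) !(linearN mxtrace, linearB mxtrace, mxtraceD) /=; ring.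
Qed.

Lemma bell_tensor_scalar (f g : 'M[C]_2) (q : 'I_4 -> C) :
  (forall b, 0 < q b) ->
  (forall k m l n, f k l * g m n = \sum_b q b * (bell_coef b k m * bell_coef b l n)) ->
  [/\ f = (f 0 0)%:M, g = (g 0 0)%:M & forall b, f 0 0 * g 0 0 = 2 * q b].
Proof.
move=> q_gt0 fg.
pose q0 := q 0; pose q1 := q (lift ord0 0); pose q2 := q (lift ord0 (lift ord0 0)).
pose q3 := q (lift ord0 (lift ord0 (lift ord0 0))).
have qE b : [\/ q b = q0, q b = q1, q b = q2 | q b = q3].
  case: b => -[|[|[|[|//]]]] lt_b; [apply: Or41|apply: Or42|apply: Or43|apply: Or44];
    by congr q; apply/val_inj.
have {}fg k m l n : f k l * g m n =
    (if (k == m) && (l == n) then q0 + (if k == l then 1 else -1) * q1 else 0) +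
    (if (k != m) && (l != n) then q2 + (if k == l then 1 else -1) * q3 else 0).
  rewrite fg !big_ord_recl big_ord0 -/q0 -/q1 -/q2 -/q3 /bell_coef /bell_sx /=.
  case: k => -[|[|//]] ?; case: m => -[|[|//]] ?; case: l => -[|[|//]] ?;
  case: n => -[|[|//]] ? /=; ring.
have e00 := fg 0 0 0 0; have e01 := fg 0 1 0 1; have e10 := fg 1 0 1 0.
have e11 := fg 1 1 1 1; have f01 := fg 0 0 1 0; have f10 := fg 1 0 0 0.
have g01 := fg 0 0 0 1; have g10 := fg 0 1 0 0.
have h01 := fg 0 0 1 1; have k01 := fg 0 1 1 0.
move: e00 e01 e10 e11 f01 f10 g01 g10 h01 k01; rewrite !eqxx /= !(addr0, add0r, mul1r).
move=> e00 e01 e10 e11 f01 f10 g01 g10 h01 k01.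
have q01_gt0 : 0 < q0 + q1 by rewrite addr_gt0 ?q_gt0.
have q23_gt0 : 0 < q2 + q3 by rewrite addr_gt0 ?q_gt0.
have f0 : f 0 0 != 0 by apply: contraL q01_gt0 => /eqP f0; rewrite -e00 f0 mul0r ltxx.
have g0 : g 0 0 != 0 by apply: contraL q01_gt0 => /eqP g0; rewrite -e00 g0 mulr0 ltxx.
have {}f01 : f 0 1 = 0 by apply: (mulIf g0); rewrite f01 mul0r.
have {}f10 : f 1 0 = 0 by apply: (mulIf g0); rewrite f10 mul0r.
have {}g01 : g 0 1 = 0 by apply: (mulfI f0); rewrite g01 mulr0.
have {}g10 : g 1 0 = 0 by apply: (mulfI f0); rewrite g10 mulr0.
have q01 : q0 = q1.
  by apply/eqP; rewrite -subr_eq0 -mulN1r -h01 f01 mul0r.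
have q23 : q2 = q3.
  by apply/eqP; rewrite -subr_eq0 -mulN1r -k01 f01 mul0r.
have q0123 : q0 + q1 = q2 + q3.
  apply/eqP; rewrite -(eqrXn2 (n := 2)) ?ltW //; apply/eqP.
  by rewrite !expr2 -{1}e00 -e11 -{1}e01 -e10; ring.
have f11 : f 1 1 = f 0 0 by apply: (mulIf g0); rewrite e10 e00.
have g11 : g 1 1 = g 0 0 by apply: (mulfI f0); rewrite e01 e00.
have mx2E (h : 'M[C]_2) : h 0 1 = 0 -> h 1 0 = 0 -> h 1 1 = h 0 0 -> h = (h 0 0)%:M.
  move=> h01' h10 h11; have ord2 (i : 'I_2) : i = 0 \/ i = 1.
    by case: i => -[|[|//]] ?; [left|right]; apply/val_inj.
  by apply/matrixP => i j; rewrite mxE; case: (ord2 i) (ord2 j) => -> [] ->.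
split; [exact: mx2E | exact: mx2E | move=> b].
rewrite e00 mulr_natl mulr2n.
case: (qE b) => ->; [by rewrite -q01 | by rewrite q01 | |].
  by rewrite q0123 -q23.
by rewrite q0123 q23.
Qed.

Lemma mxtrace_outer_sum m n (S : 'M[C]_(m * n)) (X : finType) (x : X -> 'M[C]_(m, n)) :
  (forall i j k l, S (mxvec_index i j) (mxvec_index k l) = \sum_s x s i j * (x s k l)^*) ->
  \tr S = \sum_s \tr (q_adj (x s) *m x s).
Proof.
move=> SE; rewrite /mxtrace big_mxvec_index.
under eq_bigr => i _ do under eq_bigr => j _ do rewrite SE.
under [RHS]eq_bigr => s _ do rewrite -/(mxtrace _) mxtrace_adj_mul.
rewrite [RHS]exchange_big; apply: eq_bigr => i _.
rewrite [RHS]exchange_big; apply: eq_bigr => j _.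
by apply: eq_bigr => s _; rewrite normCK.
Qed.

Lemma tsirelson_anticommute d (C0 C1 : 'M[C]_d) :
  q_hermitian C0 -> q_hermitian C1 -> C0 *m C0 = 1%:M -> C1 *m C1 = 1%:M ->
  let z := (sqrtC 2)^-1 *: (C0 + C1)^T in
  let w := (sqrtC 2)^-1 *: (C0 - C1)^T in
  [/\ q_hermitian z, q_hermitian w, z *m w = - (w *m z) & z *m z + w *m w = 2%:M].
Proof.
move=> hC0 hC1 C00 C11 z w.
have rC : ((sqrtC 2)^-1)^* = (sqrtC 2 : C)^-1.
  by rewrite geC0_conj // invr_ge0 sqrtC_ge0 ler0n.
have rr : (sqrtC 2)^-1 * (sqrtC 2)^-1 = (2 : C)^-1 by rewrite -invfM -expr2 sqrtCK.
split.
- by rewrite /q_hermitian q_adjZ rC q_adj_tr q_adjD hC0 hC1.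
- by rewrite /q_hermitian q_adjZ rC q_adj_tr q_adjB hC0 hC1.
- rewrite /z /w -!scalemxAl -!scalemxAr !scalerA -scalerN -!trmx_mul; congr (_ *: _).
  apply: trmx_inj; rewrite linearN /= !trmxK.
  rewrite !mulmxDl !mulmxDr !mulmxN !mulNmx C00 C11.
  by move: (C0 *m C1) (C1 *m C0) => D E; apply/matrixP => i j; rewrite !mxE; ring.
- rewrite /z /w -!scalemxAl -!scalemxAr !scalerA -scalerDr -!trmx_mul rr.
  rewrite !mulmxDl !mulmxDr !mulmxN !mulNmx C00 C11.
  move: (C0 *m C1) (C1 *m C0) => D E; apply/matrixP => i j; rewrite !mxE eq_sym.
  by field.
Qed.

Section Outcome.
Variables (dA dB1 dB2 dC : nat) (t1 : 'M[C]_(dA * dB1)) (t2 : 'M[C]_(dB2 * dC)).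
Variables (A0 A1 : 'M[C]_dA) (C0 C1 : 'M[C]_dC).
Variables (S S' : finType) (g : S -> 'M[C]_(dA, dB1)) (g' : S' -> 'M[C]_(dB2, dC)).
Hypotheses (hA0 : q_hermitian A0) (hA1 : q_hermitian A1).
Hypotheses (hC0 : q_hermitian C0) (hC1 : q_hermitian C1).
Hypotheses (A00 : A0 *m A0 = 1%:M) (A11 : A1 *m A1 = 1%:M).
Hypotheses (C00 : C0 *m C0 = 1%:M) (C11 : C1 *m C1 = 1%:M).
Hypothesis t1E : forall i j k l,
  t1 (mxvec_index i j) (mxvec_index k l) = \sum_s g s i j * (g s k l)^*.
Hypothesis t2E : forall i j k l,
  t2 (mxvec_index i j) (mxvec_index k l) = \sum_s g' s i j * (g' s k l)^*.

Let z := (sqrtC 2)^-1 *: (C0 + C1)^T.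
Let w := (sqrtC 2)^-1 *: (C0 - C1)^T.

Definition swap_kraus_left (s : S) (k : 'I_2) : 'M[C]_(dB1, dA) :=
  (swap_left A0 A1 k *m g s)^T.

Definition swap_kraus_right (s : S') (m : 'I_2) : 'M[C]_(dB2, dC) :=
  g' s *m swap_right z w m.

Lemma q_tensmap_swap_kraus (B : 'M[C]_(dB1 * dB2)) (b : 'I_4) :
  q_psd B -> 0 < q_prob t1 t2 B ->
  \tr (q_W A0 A1 C0 C1 b *m q_post t1 t2 B) = 2 * sqrtC 2 ->
  exists q, 0 < q /\ forall k m l n,
    q_tensmap (kraus_map swap_kraus_left) (kraus_map swap_kraus_right) B
      (mxvec_index k m) (mxvec_index l n) =
    q * (bell_coef b k m * bell_coef b l n).
Proof.
move=> /q_psd_tensor_factor[h hE] p_gt0 max.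
have [hz hw zw zzww] := tsirelson_anticommute hC0 hC1 C00 C11.
rewrite -/z -/w in hz hw zw zzww.
pose be q := map_mx Num.conj (h q).
have beE i k j l : B (mxvec_index i k) (mxvec_index j l) =
    \sum_q (be q i k)^* * be q j l.
  by rewrite hE; apply: eq_bigr => q _; rewrite !mxE conjCK.
pose x (i : 'I_(dB1 * dB2) * (S * S')) := g i.2.1 *m be i.1 *m g' i.2.2.
have sum3 (F : 'I_(dB1 * dB2) -> S -> S' -> C) :
    \sum_q \sum_s \sum_u F q s u = \sum_i F i.1 i.2.1 i.2.2.
  by under eq_bigr => q _ do rewrite pair_big; rewrite pair_big.
pose T := q_ptrace_mid (q_embB dA dC B *m q_tau t1 t2).
have TE a c a' c' : T (mxvec_index a c) (mxvec_index a' c') =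
    \sum_i x i a c * (x i a' c')^*.
  by rewrite (q_ptrace_mid_outer_sum t1E t2E beE) sum3.
pose p := \sum_i \tr (q_adj (x i) *m x i).
have pE : q_prob t1 t2 B = p.
  by rewrite /q_prob -mxtrace_ptrace_mid; apply: mxtrace_outer_sum.
rewrite pE in p_gt0; have p_neq0 := lt0r_neq0 p_gt0.
have r_neq0 : sqrtC 2 != 0 :> C by rewrite sqrtC_eq0 pnatr_eq0.
pose s := bell_sz b; pose t := bell_sx b.
have sumW : \sum_i (s * \tr (q_adj (x i) *m (A0 *m x i *m z)) +
                    t * \tr (q_adj (x i) *m (A1 *m x i *m w))) = 2 * p.
  have := max; rewrite /q_post -/T pE -scalemxAr mxtraceZ (trace_q_W _ _ _ _ _ TE).
  move/(canRL (mulKf (invr_neq0 p_neq0))); rewrite invrK => sumE.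
  apply: (mulfI r_neq0); transitivity (p * (2 * sqrtC 2)); last by ring.
  rewrite -sumE mulr_sumr; apply: eq_bigr => i _.
  by rewrite /z /w /s /t -!scalemxAr !mxtraceZ; field.
have sos0 i : (A0 *m x i = s *: (x i *m z)) /\ (A1 *m x i = t *: (x i *m w)).
  pose N0 j := A0 *m x j - s *: (x j *m z); pose N1 j := A1 *m x j - t *: (x j *m w).
  have sumN : \sum_j (\tr (q_adj (N0 j) *m N0 j) + \tr (q_adj (N1 j) *m N1 j)) = 0.
    under eq_bigr => j _ do rewrite tsirelson_sos ?bell_sz_sqr ?bell_sz_conj ?bell_sx_sqr
      ?bell_sx_conj // -addrA -opprD mulrnBl.
    by rewrite sumrB !sumrMnl sumW -/p; ring.
  move/eqP: sumN; rewrite psumr_eq0 => [/allP/(_ i (mem_index_enum _))|j _]; last first.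
    by rewrite addr_ge0 ?mxtrace_adj_mul_ge0.
  rewrite paddr_eq0 ?mxtrace_adj_mul_ge0 // => /andP[/eqP/mxtrace_adj_mul_eq0 N0i].
  move=> /eqP/mxtrace_adj_mul_eq0 N1i.
  by split; apply/eqP; rewrite -subr_eq0; apply/eqP.
pose r i := swap_vec z w (x i) b.
pose nr := \sum_i \tr (q_adj (r i) *m r i).
have nr_gt0 : 0 < nr.
  rewrite lt_def sumr_ge0 ?andbT => [|i _]; last exact: mxtrace_adj_mul_ge0.
  apply: contraNneq p_neq0 => nr0; rewrite /p big1 // => i _.
  suff -> : x i = 0 by rewrite mulmx0 mxtrace0.
  have [xz xw] := sos0 i.
  apply: (swap_vec_eq0 A11 zw xw).
  apply: mxtrace_adj_mul_eq0; apply/eqP; move/eqP: nr0.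
  rewrite psumr_eq0 => [/allP/(_ i (mem_index_enum _))//|j _].
  exact: mxtrace_adj_mul_ge0.
exists (4 * nr); split=> [|k m l n]; first by rewrite mulr_gt0 ?ltr0n.
rewrite (q_tensmap_kraus _ _ beE) sum3 mulr_sumr mulr_suml; apply: eq_bigr => i _.
have [xz xw] := sos0 i.
have E k' m' : (swap_kraus_left i.2.1 k')^T *m be i.1 *m swap_kraus_right i.2.2 m' =
    (2 * bell_coef b k' m') *: r i.
  rewrite /r -(swap_vecE A00 A11 zw xz xw) trmxK /swap_kraus_right /x.
  by rewrite !mulmxA.
rewrite !E q_adjZ -scalemxAl -scalemxAr !mxtraceZ rmorphM /= bell_coef_conj conjC_nat.
ring.
Qed.
End Outcome.
End BellSelfTest.


Theorem theorem1 (C : numClosedFieldType) (dA dB1 dB2 dC : nat)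
  (tAB1 : 'M[C]_(dA * dB1)) (tB2C : 'M[C]_(dB2 * dC))
  (B : 'I_4 -> 'M[C]_(dB1 * dB2))
  (A0 A1 : 'M[C]_dA) (C0 C1 : 'M[C]_dC) :
  q_density tAB1 -> q_density tB2C -> q_povm4 B ->
  q_hermitian A0 -> q_hermitian A1 -> q_hermitian C0 -> q_hermitian C1 ->
  A0 *m A0 = 1%:M -> A1 *m A1 = 1%:M -> C0 *m C0 = 1%:M -> C1 *m C1 = 1%:M ->
  (forall b : 'I_4,
     0 < q_prob tAB1 tB2C (B b) /\
     \tr (q_W A0 A1 C0 C1 b *m q_post tAB1 tB2C (B b)) = 2 * sqrtC 2) ->
  exists (L1 : 'M[C]_dB1 -> 'M[C]_2) (L2 : 'M[C]_dB2 -> 'M[C]_2),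
    [/\ q_lin L1, q_lin L2, q_cp L1 /\ q_cp L2, q_unital L1 /\ q_unital L2 &
        forall b : 'I_4, q_tensmap L1 L2 (B b) = q_bell C b].
Proof.
move=> [psd1 _] [psd2 _] [psdB sumB] hA0 hA1 hC0 hC1 A00 A11 C00 C11 max.
have [g gE] := q_psd_tensor_factor psd1; have [g' gE'] := q_psd_tensor_factor psd2.
pose K := swap_kraus_left A0 A1 g; pose K' := swap_kraus_right C0 C1 g'.
have /fin_all_exists[q qP] (b : 'I_4) : exists q, 0 < q /\ forall k m l n,
    q_tensmap (kraus_map K) (kraus_map K') (B b) (mxvec_index k m) (mxvec_index l n) =
    q * (bell_coef C b k m * bell_coef C b l n).
  have [p_gt0 Wb] := max b.
  exact: (q_tensmap_swap_kraus hA0 hA1 hC0 hC1 A00 A11 C00 C11 gE gE').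
pose f := kraus_map K 1%:M; pose f' := kraus_map K' 1%:M.
have [fE f'E ff'] : [/\ f = (f 0 0)%:M, f' = (f' 0 0)%:M &
    forall b, f 0 0 * f' 0 0 = 2 * q b].
  apply: bell_tensor_scalar => [b|k m l n]; first by case: (qP b).
  rewrite -q_tensmap1_kraus -sumB q_tensmap_sum summxE.
  by apply: eq_bigr => b _; case: (qP b) => _ ->.
have kraus_ge0 (S : finType) n h (H : S -> 'I_2 -> 'M[C]_(n, h)) : 0 <= kraus_map H 1%:M 0 0.
  by rewrite mxE; apply: sumr_ge0 => s _; rewrite mulmx1 mxtrace_adj_mul_ge0.
have q_neq0 b : q b != 0 by rewrite gt_eqF //; case: (qP b).
have := ff' 0; have : 2 * q 0 != 0 by rewrite mulf_neq0 ?pnatr_eq0.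
move=> + e0; rewrite -e0 mulf_eq0 negb_or => /andP[f_neq0 f'_neq0].
pose a := sqrtC (f 0 0)^-1; pose a' := sqrtC (f' 0 0)^-1.
have aa : a^* * a = (f 0 0)^-1.
  by rewrite geC0_conj ?sqrtC_ge0 ?invr_ge0 ?kraus_ge0 // -expr2 sqrtCK.
have aa' : a'^* * a' = (f' 0 0)^-1.
  by rewrite geC0_conj ?sqrtC_ge0 ?invr_ge0 ?kraus_ge0 // -expr2 sqrtCK.
exists (kraus_map (fun s i => a *: K s i)), (kraus_map (fun s i => a' *: K' s i)).
split; [exact: kraus_map_lin | exact: kraus_map_lin | by split; apply: kraus_map_cp | |].
  split; rewrite /q_unital kraus_map_scale.
    by rewrite aa -/f {2}fE scale_scalar_mx mulVf.
  by rewrite aa' -/f' {2}f'E scale_scalar_mx mulVf.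
move=> b; rewrite q_tensmap_kraus_scale aa aa' -invfM (ff' b).
apply/matrixP => i j; case/mxvec_indexP: i => k m; case/mxvec_indexP: j => l n.
rewrite mxE q_bellE; case: (qP b) => _ ->.
by rewrite invfM -mulrA mulKf.
Qed.
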